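(* Let $\alpha$ be an integer with $|\alpha|\ge2$, and consider two copies $\Sigma_1,\Sigma_2$ of the control system $x_{k+1}=(\alpha x_k+u_k)\bmod 1$ on the unit circle $\mathrm{S}^1=\mathbb{R}/\mathbb{Z}$ with $u_k\in U:=[-1,1]$. For $\delta>0$ let $$Q=\left\{(x^{(1)},x^{(2)})\in\mathrm{S}^1\times\mathrm{S}^1:\ d(x^{(1)},x^{(2)})\le\delta\right\},$$ where $d(x+\mathbb{Z},y+\mathbb{Z})=\min_{j\in\mathbb{Z}}|x-y+j|$. Then, for all sufficiently small $\delta>0$, the network entropy set of the product system with respect to $Q$ (practical synchronization) is given by $$H(Q)=\left\{(h_1,h_2)\in\mathbb{R}^2:\ h_1,h_2\ge0,\ h_1+h_2\ge\log|\alpha|\right\}.$$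
   Context: Logarithms are to base 2; $\mathbb{Z}_+$ denotes the nonnegative integers; $\tau,t$ range over positive integers. Put $\mathcal{U}_1=\mathcal{U}_2=[-1,1]^{\mathbb{Z}_+}$ and $\mathcal{U}=\mathcal{U}_1\times\mathcal{U}_2$. For $x=(x_1,x_2)\in\mathrm{S}^1\times\mathrm{S}^1$ and $\omega=(\omega_1,\omega_2)\in\mathcal{U}$, $\varphi(k,x,\omega)$ denotes the state at time $k$ of the product system started at $x$, where the $i$-th component evolves according to $\Sigma_i$ with control sequence $\omega_i$. A set $\mathcal{S}\subset\mathcal{U}$ is $(\tau,Q)$-spanning if for every $x\in Q$ there is $\omega\in\mathcal{S}$ with $\varphi(k,x,\omega)\in\operatorname{int}Q$ for $k=1,\ldots,\tau$. For $\tau>0$ let $$H_\tau(Q)=\left\{\tfrac1\tau(\log\#\mathcal{S}_1,\log\#\mathcal{S}_2):\ \mathcal{S}_i\subset\mathcal{U}_i,\ \mathcal{S}_1\times\mathcal{S}_2\text{ finite and }(\tau,Q)\text{-spanning}\right\}\subset\mathbb{R}^2.$$ The network entropy set is $H(Q)=\bigcap_{\tau>0}\operatorname{cl}\bigcup_{t\ge\tau}H_t(Q)$. *)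

(* Defs.v *)
From HB Require Import structures.
From mathcomp Require Import all_boot all_order all_algebra.
From mathcomp Require Import generic_quotient ring_quotient finmap.
From mathcomp Require Import all_classical all_reals all_analysis.
From mathcomp Require Import zify ring lra.

Set Implicit Arguments.
Unset Strict Implicit.
Unset Printing Implicit Defensive.

Import Order.TTheory GRing.Theory Num.Theory.
Import numFieldNormedType.Exports.

Local Open Scope classical_set_scope.
Local Open Scope ring_scope.
Local Open Scope quotient_scope.

Definition log2 {R : realType} (x : R) : R := ln x / ln 2.

(* [Num.int_num_subdef] is the predicate underlying [Num.int]. *)
Definition Zsubgroup (R : realType) : zmodClosed R :=
  GRing.ZmodClosed.clone R (@Num.int_num_subdef R) _.

(* R/Z with the quotient topology. *)
Definition circle (R : realType) : Type :=
  quotient_topology (Quotient.quot (Zsubgroup R)).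
HB.instance Definition _ (R : realType) := Topological.on (circle R).
HB.instance Definition _ (R : realType) := Quotient.on (circle R).

(* Copying the [zmodType] of [Quotient.quot] would bring in an [eqType] that is
   not convertible to the one underlying the topology. *)
HB.instance Definition _ (R : realType) := GRing.isZmodule.Build (circle R)
  (@Quotient.addqA _ (Zsubgroup R)) (@Quotient.addqC _ (Zsubgroup R))
  (@Quotient.add0q _ (Zsubgroup R)) (@Quotient.addNq _ (Zsubgroup R)).

Definition mod1 {R : realType} : R -> circle R := \pi_(circle R).

Lemma mod1_is_zmod_morphism (R : realType) : zmod_morphism (@mod1 R).
Proof.
by move=> x y; rewrite /mod1 (@Quotient.pi_add _ (Zsubgroup R))
  (@Quotient.pi_opp _ (Zsubgroup R)).
Qed.
HB.instance Definition _ (R : realType) :=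
  GRing.isZmodMorphism.Build R (circle R) mod1 (@mod1_is_zmod_morphism R).

(* The infimum is attained and does not depend on the representatives chosen
   by [repr]; see [circle_dist_min] below. *)
Definition circle_dist {R : realType} (x y : circle R) : R :=
  inf [set `|repr x - repr y + j%:~R| | j in [set: int]].

Lemma mod1_eq {R : realType} (x y : R) :
  mod1 x = mod1 y <-> exists j : int, x - y = j%:~R.
Proof.
have E := Quotient.idealrBE (Zsubgroup R) x y; split=> [e|[j xyj]].
  have : x - y \in Zsubgroup R by rewrite E; apply/eqP.
  by move=> h; apply/intrP.
have : x - y \in Zsubgroup R by rewrite xyj; exact: intr_int.
by rewrite E => /eqP.
Qed.

Lemma mod1_repr {R : realType} (x : circle R) : mod1 (repr x) = x.
Proof. exact: reprK. Qed.

Lemma circle_dist_min {R : realType} (x y : R) :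
  (exists j : int, circle_dist (mod1 x) (mod1 y) = `|x - y + j%:~R|) /\
  (forall j : int, circle_dist (mod1 x) (mod1 y) <= `|x - y + j%:~R|).
Proof.
have [m xm] : exists j : int, repr (mod1 x) - x = j%:~R.
  by apply/mod1_eq; exact: mod1_repr.
have [n yn] : exists j : int, repr (mod1 y) - y = j%:~R.
  by apply/mod1_eq; exact: mod1_repr.
have -> : circle_dist (mod1 x) (mod1 y) =
    inf [set `|x - y + j%:~R| | j in [set: int]].
  have e : repr (mod1 x) - repr (mod1 y) = x - y + (m - n)%:~R.
    by rewrite intrB -xm -yn; ring.
  congr inf; apply/seteqP; split => _ [j _ <-].
    by exists (m - n + j) => //; rewrite e; congr `|_|; ring.
  by exists (j - (m - n)) => //; rewrite e; congr `|_|; ring.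
set A := [set _ | _ in _].
have lbA : has_lbound A by exists 0 => _ [j _ <-].
split; last by move=> j; apply: ge_inf => //; exists j.
set z := x - y; set k := Num.floor z; set f := z - k%:~R.
have f0 : 0 <= f by rewrite subr_ge0 floor_le_tmp.
have f1 : f < 1 by rewrite ltrBlDl -intrD1 floorD1_gt.
suff [j lej] : exists j : int, forall i : int, `|z + j%:~R| <= `|z + i%:~R|.
  exists j; apply/eqP; rewrite eq_le; apply/andP; split.
    by apply: ge_inf => //; exists j.
  by apply: lb_le_inf; [exists `|z + j%:~R|; exists j|move=> _ [i _ <-]].
exists (if f <= 1 - f then - k else - k - 1) => i.
have -> : `|z + (if f <= 1 - f then - k else - k - 1)%:~R| = Num.min f (1 - f).
  case: leP => ff; first by rewrite intrN -/f ger0_norm.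
  rewrite intrB intrN addrA -/f -normrN opprB ger0_norm //.
  by rewrite subr_ge0 ltW.
have -> : z + i%:~R = f + (k + i)%:~R by rewrite intrD addrA subrK.
have [ki|ki] := leP 0 (k + i).
  rewrite ger0_norm; last by rewrite addr_ge0 // ler0z.
  by rewrite ge_min lerDl ler0z ki.
have h : (k + i)%:~R <= -1 :> R by rewrite -[-1]/((-1)%:~R) ler_int; lia.
rewrite ge_min; apply/orP; right.
by rewrite ler0_norm; lra.
Qed.

(* A discrete-time control system x_(k+1) = step x_k u_k whose controls u_k
   are restricted to the set [input_range]. *)
Record control_system := ControlSystem {
  state : topologicalType;
  input : choiceType;
  input_range : set input;
  step : state -> input -> state
}.

Definition control_seqs (S : control_system) : set (nat -> input S) :=
  [set w | forall k, input_range (w k)].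

Fixpoint trajectory (S : control_system) (k : nat) (x : state S)
    (w : nat -> input S) : state S :=
  if k is k'.+1 then step (trajectory k' x w) (w k') else x.

Section NetworkEntropy.
Variables (R : realType) (Sigma1 Sigma2 : control_system).
Let X : topologicalType := (state Sigma1 * state Sigma2)%type.
Let controls : Type := ((nat -> input Sigma1) * (nat -> input Sigma2))%type.

Definition product_trajectory (k : nat) (x : X) (w : controls) : X :=
  (trajectory k x.1 w.1, trajectory k x.2 w.2).

Definition spanning (tau : nat) (Q : set X) (W : set controls) : Prop :=
  forall x, Q x -> exists2 w, W w &
    forall k, (1 <= k <= tau)%N -> interior Q (product_trajectory k x w).

(* [fset_set W] is a junk value for infinite [W]; for nonempty [Q], a spanning
   [W1 `*` W2] is nonempty, so its finiteness makes both factors finite. *)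
Definition entropy_pairs (tau : nat) (Q : set X) : set (R * R) :=
  [set h | exists W1 W2,
    [/\ W1 `<=` @control_seqs Sigma1, W2 `<=` @control_seqs Sigma2,
        finite_set (W1 `*` W2), spanning tau Q (W1 `*` W2) &
        h = (tau%:R^-1 * log2 (#|` fset_set W1|)%:R,
             tau%:R^-1 * log2 (#|` fset_set W2|)%:R)]].

Definition network_entropy_set (Q : set X) : set (R * R) :=
  \bigcap_(tau in [set tau | (0 < tau)%N])
    closure (\bigcup_(t in [set t | (tau <= t)%N]) entropy_pairs t Q).

End NetworkEntropy.

Arguments network_entropy_set R Sigma1 Sigma2 Q : clear implicits.

Definition circle_system (R : realType) (alpha : int) : control_system :=
  @ControlSystem (circle R) R `[-1, 1]%classic
    (fun x u => x *~ alpha + mod1 u).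

Definition practical_synchronization (R : realType) (delta : R) :
    set (circle R * circle R) :=
  [set x | circle_dist x.1 x.2 <= delta].

(* Main.v *)
(* Only the gap x1 - x2 matters; it evolves by z |-> alpha z + u1 - u2.
   Lower bound: for small delta, two initial gaps in [-delta, delta] kept in
   [-delta, delta] up to time t by the same controls are at distance at most
   2 delta / |alpha|^t, so each of |alpha|^t equidistant gaps needs its own pair
   of controls and #S1 #S2 >= |alpha|^t.
   Upper bound: the correction of the gap can be split additively between the
   two inputs, in any proportion n1, n2 with n1 n2 > 2 |alpha|^t; n_i is taken
   of the order of 2^(t h_i). *)
Require Import Defs.
From HB Require Import structures.
From mathcomp Require Import all_boot all_order all_algebra.
From mathcomp Require Import finmap.
From mathcomp Require Import all_classical all_reals all_analysis.
From mathcomp Require Import zify ring lra.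

Import Order.TTheory GRing.Theory Num.Theory.
Import numFieldNormedType.Exports.

Local Open Scope classical_set_scope.
Local Open Scope ring_scope.

(** * Base-2 logarithms and rounding of powers of 2 *)

Section Log2.
Context {R : realType}.
Implicit Types x y : R.

Lemma ln2_gt0 : 0 < ln 2 :> R.
Proof. by apply: ln_gt0; lra. Qed.

Lemma le_log2 x y : 0 < x -> x <= y -> log2 x <= log2 y.
Proof.
move=> x0 xy; rewrite /log2 ler_pM2r ?invr_gt0 ?ln2_gt0// ler_ln// posrE//.
exact: lt_le_trans xy.
Qed.

Lemma log2M x y : 0 < x -> 0 < y -> log2 (x * y) = log2 x + log2 y.
Proof. by move=> x0 y0; rewrite /log2 lnM ?posrE// mulrDl. Qed.

Lemma log2_powR x : log2 (2 `^ x : R) = x.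
Proof. by rewrite /log2 ln_powR mulfK// gt_eqF// ln2_gt0. Qed.

Lemma log2_2 : log2 2 = 1 :> R.
Proof. by rewrite -[X in log2 X]powRr1// log2_powR. Qed.

Lemma log2X x n : 0 < x -> log2 (x ^+ n) = n%:R * log2 x.
Proof. by move=> x0; rewrite /log2 lnXn// mulr_natl mulrnAl. Qed.

Lemma log2_nat_ge0 n : (0 < n)%N -> 0 <= log2 n%:R :> R.
Proof.
by move=> n0; rewrite /log2 divr_ge0 ?ln_ge0 ?ler1n// ltW// ln2_gt0.
Qed.

(** Rounding [2 ^ x] up to an integer costs at most one bit: since [2 ^ x >= 1], adding 1 at most
    doubles it. *)
Lemma log2_truncn_powR x : 0 <= x ->
  x <= log2 (Num.truncn (2 `^ x)).+1%:R <= x + 1.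
Proof.
move=> x0; have p1 : 1 <= 2 `^ x :> R.
  by rewrite -[X in X <= _](powRr0 2); apply: ler_powR => //; lra.
have p0 : 0 < 2 `^ x :> R by apply: powR_gt0.
apply/andP; split.
  by rewrite -{1}(log2_powR x); apply: le_log2 => //; exact/ltW/truncnS_gt.
have <- : log2 (2 `^ x * 2) = x + 1 :> R by rewrite log2M// log2_powR log2_2.
apply: le_log2 => //.
by have /andP[h _] := truncn_itv (ltW p0); rewrite -natr1; lra.
Qed.

End Log2.

(** * Synchronization on the circle in terms of real representatives *)

Section CircleTopology.
Context {R : realType}.
Implicit Types (x y d : R).

(* Translates of a ball by integers are open, so [mod1] is an open map. *)
Lemma open_mod1_ball x (e : R) : open (mod1 @` ball x e : set (circle R)).
Proof.
rewrite /open/= /quotient_open.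
rewrite (_ : _ @^-1` _ = \bigcup_(j in [set: int]) ball (x + j%:~R) e).
  by apply: bigcup_open => j _; exact: ball_open.
apply/seteqP; split=> [y /= [z zx /mod1_eq [j zyj]]|y [j _ yxj]].
  exists (- j) => //; move: zx; rewrite -ball_normE /ball_/=.
  by rewrite intrN -zyj; congr (`|_| < _); ring.
exists (y - j%:~R); last first.
  by apply/mod1_eq; exists (- j); rewrite intrN; ring.
by move: yxj; rewrite -ball_normE /ball_/=; congr (`|_| < _); ring.
Qed.

(** The minimum over integer shifts is attained, so a bound on the distance becomes an existential
    over integers. *)
Lemma practical_synchronizationP d x y :
  practical_synchronization d (mod1 x, mod1 y) <->
  exists j : int, `|x - y + j%:~R| <= d.
Proof.
have [[j dj] dle] := circle_dist_min x y.
rewrite /practical_synchronization/=; split=> [|[i id]].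
  by exists j; rewrite -dj.
exact: le_trans id.
Qed.

(** The slack [d - |x - y|] is shared equally by balls around [x] and [y], whose images on the
    circle are open. *)
Lemma interior_practical_synchronization d x y : `|x - y| < d ->
  interior (practical_synchronization d) (mod1 x, mod1 y).
Proof.
move=> xyd; set e := (d - `|x - y|) / 2.
have e0 : 0 < e by rewrite divr_gt0// subr_gt0.
exists (mod1 @` ball x e, mod1 @` ball y e) => /=.
  by split; apply: open_nbhs_nbhs; split; try exact: open_mod1_ball;
    [exists x|exists y] => //; exact: ballxx.
move=> [_ _] /= [[u xu <-] [v yv <-]].
apply/practical_synchronizationP; exists 0; rewrite addr0.
move: xu yv; rewrite -!ball_normE /ball_/= => xu yv.
have -> : u - v = (x - y) - (x - u) + (y - v) by ring.
have := ler_normD ((x - y) - (x - u)) (y - v).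
have := ler_normB (x - y) (x - u).
by move: xu yv; rewrite /e; lra.
Qed.

End CircleTopology.

(** * Trajectories lifted to the real line *)

Section Lift.
Context {R : realType}.
Implicit Types (a x y : R) (w : nat -> R) (k : nat).

Fixpoint lifted_trajectory a k x w : R :=
  if k is k'.+1 then a * lifted_trajectory a k' x w + w k' else x.

Lemma trajectory_mod1 (alpha : int) k x w :
  @trajectory (circle_system R alpha) k (mod1 x) w =
  mod1 (lifted_trajectory alpha%:~R k x w).
Proof.
elim: k => //= k ->; rewrite raddfD/=; congr (_ + _).
by rewrite mulrzl raddfMz.
Qed.

Lemma lifted_trajectoryB a k x y w :
  lifted_trajectory a k x w - lifted_trajectory a k y w = a ^+ k * (x - y).
Proof.
elim: k => [|k IH] /=; first by rewrite mul1r.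
by rewrite exprS -mulrA -IH; ring.
Qed.

(** One correction at time 0 is enough if it brings the gap so close to 0 that [t] expansions keep
    it below [delta]. *)
Definition impulse (c : R) : nat -> R := fun k => if k is 0%N then c else 0.

Lemma lifted_trajectory_impulse a k x c :
  lifted_trajectory a k.+1 x (impulse c) = a ^+ k * (a * x + c).
Proof.
elim: k => [|k IH]; first by rewrite mul1r.
have -> : lifted_trajectory a k.+2 x (impulse c) =
  a * lifted_trajectory a k.+1 x (impulse c) + 0 by [].
by rewrite IH exprS; ring.
Qed.

Lemma impulse_control (alpha : int) c : `|c| <= 1 ->
  @control_seqs (circle_system R alpha) (impulse c).
Proof.
by move=> c1 [|k] /=; rewrite in_itv/= -ler_norml ?normr0 ?ler01.
Qed.

End Lift.

(** * Lower bound by counting controls *)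

Section LowerBound.
Context {R : realType}.
Variables (alpha : int) (delta : R).
Let a : R := alpha%:~R.
Let Q := practical_synchronization delta.
Let Sigma := circle_system R alpha.

(* Smallness of [delta] excludes wrapping around the circle: the difference of
   the two gaps is at most [2 |a| delta] before reduction and lies within
   [2 delta] of an integer, which is therefore [0]. *)
Lemma same_control_close t x x' y (w : (nat -> R) * (nat -> R)) :
  2 * delta + 2 * `|a| * delta < 1 -> `|x - x'| <= 2 * delta ->
  (forall k, (1 <= k <= t)%N ->
    Q (@product_trajectory Sigma Sigma k (mod1 x, mod1 y) w)) ->
  (forall k, (1 <= k <= t)%N ->
    Q (@product_trajectory Sigma Sigma k (mod1 x', mod1 y) w)) ->
  `|a| ^+ t * `|x - x'| <= 2 * delta.
Proof.
move=> delta_small xx' Qx Qx'.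
(* All intermediate times enter the induction: the bound at time [k] gives the a priori bound
   [2 |a| delta] at time [k + 1]. *)
suff : forall k, (k <= t)%N -> `|a ^+ k * (x - x')| <= 2 * delta.
  by move=> /(_ t (leqnn t)); rewrite normrM normrX.
elim=> [|k IH] kt; first by rewrite mul1r.
have /IH{}IH : (k <= t)%N by exact: ltnW.
have bound z : (forall k, (1 <= k <= t)%N ->
    Q (@product_trajectory Sigma Sigma k (mod1 z, mod1 y) w)) ->
  exists j : int, `|lifted_trajectory a k.+1 z w.1 -
    lifted_trajectory a k.+1 y w.2 + j%:~R| <= delta.
  move=> /(_ k.+1 kt); rewrite /product_trajectory !trajectory_mod1.
  by move/practical_synchronizationP.
have [j xj] := bound _ Qx; have [j' xj'] := bound _ Qx'.
set e := a ^+ k.+1 * (x - x').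
have ee : `|e| <= 2 * `|a| * delta.
  have -> : e = a * (a ^+ k * (x - x')) by rewrite /e exprS; ring.
  by rewrite normrM mulrAC mulrC ler_wpM2r// mulrC.
have ej : `|e + (j - j')%:~R| <= 2 * delta.
  rewrite /e -(lifted_trajectoryB a k.+1 x x' w.1) intrB.
  apply: le_trans (_ : delta + delta <= _); last by lra.
  apply: le_trans (lerD xj xj'); apply: le_trans (ler_normB _ _).
  by rewrite le_eqVlt; apply/orP; left; apply/eqP; congr `|_|; ring.
have : `|(j - j')%:~R : R| < 1.
  have -> : (j - j')%:~R = (e + (j - j')%:~R) - e by ring.
  by have := ler_normB (e + (j - j')%:~R) e; move: ee ej delta_small; lra.
rewrite -intr_norm -[1]/(1%:~R) ltr_int => jj.
have jj0 : j - j' = 0 by lia.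
by move: ej; rewrite jj0 addr0.
Qed.

(** Choosing a control pair for each of [|alpha| ^ t] equidistant gaps gives an injection into the
    product of the two control sets. *)
Lemma spanning_card_ge t (W1 W2 : set (nat -> R)) : 2 <= `|alpha| ->
  0 < delta -> 2 * delta + 2 * `|a| * delta < 1 -> (0 < t)%N ->
  finite_set W1 -> finite_set W2 ->
  @spanning Sigma Sigma t Q (W1 `*` W2) ->
  (`|alpha| ^ t <= #|` fset_set W1| * #|` fset_set W2|)%N.
Proof.
move=> halpha delta_gt0 delta_small t0 fW1 fW2 span.
set N := (`|alpha| ^ t)%N.
have NR : N%:R = `|a| ^+ t :> R by rewrite natrX natr_absz intr_norm.
have N1 : (1 < N)%N by rewrite -(exp1n t) ltn_exp2r//; lia.
have N1R : 1 < N%:R :> R by rewrite ltr1n.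
(* Both endpoints of [[-delta, delta]] are grid points, hence the divisor [N - 1]; the spacing then
   strictly exceeds [2 delta / N]. *)
pose gap : R := 2 * delta / (N%:R - 1).
have gap0 : 0 < gap by rewrite divr_gt0//; lra.
have gapN : gap * (N%:R - 1) = 2 * delta by rewrite divfK// gt_eqF//; lra.
pose z (m : 'I_N) : R := - delta + m%:R * gap.
have zd m : `|z m| <= delta.
  have : m%:R <= N%:R - 1 :> R by rewrite lerBrDr natr1 ler_nat.
  have : 0 <= m%:R :> R by [].
  rewrite /z => m0 mN; rewrite ler_norml; apply/andP; split.
    by rewrite lerDl mulr_ge0// ltW.
  have : gap * m%:R <= gap * (N%:R - 1) by rewrite ler_pM2l.
  by rewrite gapN; lra.
have Qz m : Q (mod1 (z m), mod1 0).
  by apply/practical_synchronizationP; exists 0; rewrite addr0 subr0.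
have /boolp.choice[w wP] (m : 'I_N) : exists v : (nat -> R) * (nat -> R),
    [/\ W1 v.1, W2 v.2 & forall k, (1 <= k <= t)%N ->
      Q (@product_trajectory Sigma Sigma k (mod1 (z m), mod1 0) v)].
  have [v [v1 v2] vP] := span _ (Qz m).
  by exists v; split=> // k kt; exact: interior_subset (vP k kt).
have w1 m : (w m).1 \in fset_set W1.
  by rewrite in_fset_set// inE; have [] := wP m.
have w2 m : (w m).2 \in fset_set W2.
  by rewrite in_fset_set// inE; have [] := wP m.
pose f m := (FSetSub (w1 m), FSetSub (w2 m)).
rewrite !cardfE -card_prod -[X in (X <= _)%N](card_ord N).
apply: (leq_card f) => m m' /= [e1 e2].
have ww : w m = w m' by rewrite (surjective_pairing (w m)) e1 e2 -surjective_pairing.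
apply/val_inj/eqP; apply: contraT => mm'.
have [_ _ Qm] := wP m; have [_ _ Qm'] := wP m'; rewrite -ww in Qm'.
have zz : `|z m - z m'| <= 2 * delta.
  by have := ler_normB (z m) (z m'); have := zd m; have := zd m'; lra.
have := same_control_close t _ _ _ _ delta_small zz Qm Qm'; rewrite -NR.
have -> : z m - z m' = (m%:Z - m'%:Z)%:~R * gap by rewrite /z intrB -!pmulrn; ring.
rewrite normrM (gtr0_norm gap0) -intr_norm => h.
have d1 : 1 <= (`|m%:Z - m'%:Z|)%:~R :> R.
  by rewrite -[1]/(1%:~R) ler_int; move: mm' => /=; lia.
(* Here [N gap = 2 delta + gap > 2 delta], contradicting the bound for gaps steered by the same
   controls. *)
have : N%:R * gap <= N%:R * ((`|m%:Z - m'%:Z|)%:~R * gap).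
  by rewrite ler_pM2l ?ler_peMl//; lra.
by move: gapN; rewrite mulrBr mulr1 [gap * _]mulrC; lra.
Qed.

Lemma entropy_pairs_lower_bound t h : 2 <= `|alpha| -> 0 < delta ->
  2 * delta + 2 * `|a| * delta < 1 -> (0 < t)%N ->
  @entropy_pairs R Sigma Sigma t Q h ->
  [/\ 0 <= h.1, 0 <= h.2 & log2 (`|alpha|%:~R) <= h.1 + h.2].
Proof.
move=> halpha delta_gt0 delta_small t0 [W1 [W2 [_ _ fW span ->]]] /=.
(* The diagonal point of [Q] makes the product nonempty, so each factor is a projection of a finite
   set and [fset_set] takes no junk value. *)
have [[v1 v2] [/= W1v W2v] _] : exists2 v, (W1 `*` W2) v & forall k, (1 <= k <= t)%N ->
    interior Q (@product_trajectory Sigma Sigma k (mod1 0, mod1 0) v).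
  apply: span; apply/practical_synchronizationP; exists 0.
  by rewrite subrr addr0 normr0 ltW.
have fW1 : finite_set W1.
  rewrite (_ : W1 = fst @` (W1 `*` W2)); first exact: finite_image.
  by apply/seteqP; split=> [u W1u|_ [u [W1u _] <-]//]; exists (u, v2).
have fW2 : finite_set W2.
  rewrite (_ : W2 = snd @` (W1 `*` W2)); first exact: finite_image.
  by apply/seteqP; split=> [u W2u|_ [u [_ W2u] <-]//]; exists (v1, u).
have := spanning_card_ge t W1 W2 halpha delta_gt0 delta_small t0 fW1 fW2 span.
set n1 := #|` _|; set n2 := #|` _| => card_ge.
have : (0 < `|alpha| ^ t)%N by rewrite expn_gt0; apply/orP; left; lia.
move=> /leq_trans/(_ card_ge); rewrite muln_gt0 => /andP[n10 n20].
have tV : 0 < t%:R^-1 :> R by rewrite invr_gt0 ltr0n.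
split; try by rewrite mulr_ge0 ?(ltW tV)// log2_nat_ge0.
rewrite -mulrDr -log2M ?ltr0n// -natrM ler_pdivlMl ?ltr0n// -log2X; last first.
  by rewrite ltr0z; lia.
apply: le_log2; first by rewrite exprn_gt0// ltr0z; lia.
by rewrite -natr_absz -natrX ler_nat.
Qed.

End LowerBound.

(** * Upper bound by impulse controls *)

Section UpperBound.
Context {R : realType}.
Variables (alpha : int) (delta : R).
Let a : R := alpha%:~R.
Let Q := practical_synchronization delta.
Let Sigma := circle_system R alpha.

(** The index [m] is that of the cell containing [z] when [[-delta, delta]] is cut into [N] equal
    cells, represented by their left ends. *)
Lemma grid_approximation (N : nat) (z : R) : 0 < delta ->
  (0 < N)%N -> `|z| <= delta ->
  exists2 m, (m < N)%N & `|z + delta - m%:R * (2 * delta / N%:R)| <= 2 * delta / N%:R.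
Proof.
move=> delta_gt0 N0 zd; set s := 2 * delta / N%:R.
have NR : 0 < N%:R :> R by rewrite ltr0n.
have s0 : 0 < s by rewrite divr_gt0//; lra.
have sN : N%:R * s = 2 * delta by rewrite mulrC divfK// gt_eqF.
have /andP[zl zr] : - delta <= z <= delta by rewrite -ler_norml.
(* At [z = delta] truncation would give the excluded index [N]; the last cell is taken instead. *)
have [z1|z1] := ltP z delta; last first.
  exists N.-1; first by rewrite prednK.
  have NN : N.-1%:R = N%:R - 1 :> R by rewrite -[in RHS](prednK N0) -natr1 addrK.
  have -> : z + delta - N.-1%:R * s = z - delta + s by rewrite NN mulrBl sN; ring.
  by rewrite ger0_norm; lra.
have q0 : 0 <= (z + delta) / s by apply: divr_ge0; [lra|exact: ltW].
exists (Num.truncn ((z + delta) / s)).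
  by rewrite truncn_lt_nat// ltr_pdivrMr// sN; lra.
have := truncn_itv q0; rewrite ler_pdivlMr// ltr_pdivrMr// -natr1 => /andP[l r].
by rewrite ger0_norm; lra.
Qed.

(* A first impulse of the first control moves the gap by [a p_i], and one of the
   second by [a q_j]; afterwards the controls vanish.  The sums [p_i + q_j] form
   an equidistant grid of [n1 * n2] points in [-delta, delta]. *)
Lemma impulse_entropy_pairs t n1 n2 : 1 <= `|a| -> 0 < delta ->
  2 * `|a| * delta <= 1 -> (0 < n1)%N -> (0 < n2)%N ->
  2 * `|a| ^+ t < (n1 * n2)%:R ->
  @entropy_pairs R Sigma Sigma t Q
    (t%:R^-1 * log2 n1%:R, t%:R^-1 * log2 n2%:R).
Proof.
move=> a_ge1 delta_gt0 delta_small n10 n20 nt; set N := (n1 * n2)%N; set s : R := 2 * delta / N%:R.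
have N0 : (0 < N)%N by rewrite muln_gt0 n10.
have NR : 0 < N%:R :> R by rewrite ltr0n.
have s0 : 0 < s by rewrite divr_gt0//; lra.
have sN : N%:R * s = 2 * delta by rewrite mulrC divfK// gt_eqF.
have small : `|a| * (2 * delta) <= 1 by lra.
have a0 : a != 0 by rewrite -normr_gt0; lra.
pose p (i : nat) : R := - delta + (i * n2)%:R * s.
pose q (j : nat) : R := j%:R * s.
pose W1 := (fun i => impulse (- (a * p i))) @` `I_n1.
pose W2 := (fun j => impulse (a * q j)) @` `I_n2.
(* Distinct indices give impulses that differ at time 0, so the control sets have exactly [n1] and
   [n2] elements. *)
have c1 : (W1 #= `I_n1)%card.
  apply: inj_card_eq => i i' _ _ /(congr1 (@^~ 0%N)) /= /oppr_inj/(mulfI a0).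
  move=> /addrI/(mulIf (lt0r_neq0 s0))/eqP; rewrite eqr_nat eqn_pmul2r//.
  by move/eqP.
have c2 : (W2 #= `I_n2)%card.
  apply: inj_card_eq => j j' _ _ /(congr1 (@^~ 0%N)) /= /(mulfI a0).
  by move=> /(mulIf (lt0r_neq0 s0))/eqP; rewrite eqr_nat => /eqP.
exists W1, W2; split.
- move=> _ [i /= i1 <-]; apply: impulse_control.
  have : `|p i| <= 2 * delta.
    have : (i * n2)%:R * s <= N%:R * s by rewrite ler_pM2r// ler_nat leq_mul// ltnW.
    have : 0 <= (i * n2)%:R * s by rewrite mulr_ge0// ltW.
    by rewrite sN /p ler_norml => ? ?; apply/andP; split; lra.
  rewrite normrN normrM => pi.
  by apply: le_trans small; rewrite ler_wpM2l.
- move=> _ [j /= j1 <-]; apply: impulse_control.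
  have : `|q j| <= 2 * delta.
    have : j%:R * s <= N%:R * s.
      by rewrite ler_pM2r// ler_nat; apply: leq_trans (ltnW j1) _; rewrite leq_pmull.
    have : 0 <= j%:R * s by rewrite mulr_ge0// ltW.
    by rewrite sN /q ler_norml => ? ?; apply/andP; split; lra.
  move=> qj; rewrite (normrM a).
  by apply: le_trans small; rewrite ler_wpM2l.
- by apply: finite_setX; apply: finite_image; exact: finite_II.
- move=> [x1 x2]; rewrite -(mod1_repr x1) -(mod1_repr x2).
  move: (repr x1) (repr x2) => x y /practical_synchronizationP [j xyd].
  (* The integer shift is absorbed into the representative [x], so that the real gap itself is at
     most [delta]. *)
  have -> : mod1 x = mod1 (x + j%:~R).
    by apply/mod1_eq; exists (- j); rewrite intrN; ring.
  move: xyd; rewrite addrAC; move: (x + _) => {}x xyd.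
  have [m mN zm] := grid_approximation N (x - y) delta_gt0 N0 xyd.
  (* Euclidean division of the grid index by [n2] gives the coarse part to the first control and the
     fine part to the second. *)
  exists (impulse (- (a * p (m %/ n2)%N)), impulse (a * q (m %% n2)%N)).
    split; [exists (m %/ n2)%N|exists (m %% n2)%N] => //=.
      by rewrite ltn_divLR.
    by rewrite ltn_pmod.
  case=> // k /andP[_ kt]; rewrite /product_trajectory !trajectory_mod1.
  apply: interior_practical_synchronization; rewrite !lifted_trajectory_impulse.
  have -> : a ^+ k * (a * x - a * p (m %/ n2)%N) -
      a ^+ k * (a * y + a * q (m %% n2)%N) =
      a ^+ k.+1 * (x - y + delta - m%:R * s).
    by rewrite {3}(divn_eq m n2) natrD /p /q exprS; ring.
  rewrite normrM normrX.
  have ak : `|a| ^+ k.+1 <= `|a| ^+ t by exact: ler_weXn2l.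
  (* The worst case is [k + 1 = t], where [|a| ^ t s = 2 delta |a| ^ t / N < delta]. *)
  apply: le_lt_trans (_ : `|a| ^+ t * s < _); first exact: ler_pM.
  rewrite -(ltr_pM2l (x := 2))// -sN mulrA ltr_pM2r//.
- by rewrite (card_fset_set c1) (card_fset_set c2).
Qed.

(** Rounding [2 ^ (t h1)] and [2 ^ (t h2)] to integers perturbs the pair by at most [2 / t], which
    vanishes as [t] grows. *)
Lemma upper_bound_closure tau h : 1 <= `|a| -> 0 < delta ->
  2 * `|a| * delta <= 1 -> 0 <= h.1 -> 0 <= h.2 ->
  log2 `|a| <= h.1 + h.2 ->
  closure (\bigcup_(t in [set t | (tau <= t)%N])
    @entropy_pairs R Sigma Sigma t Q) h.
Proof.
case: h => h1 h2 /= a_ge1 delta_gt0 delta_small h10 h20 h12 B /nbhs_ballP [e /= e0 eB].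
pose t := (maxn tau (Num.truncn (2 / e))).+1.
have tR : 0 < t%:R :> R by rewrite ltr0n.
have te : 2 < e * t%:R.
  rewrite mulrC -ltr_pdivrMr//; apply: lt_le_trans (truncnS_gt _) _.
  by rewrite ler_nat ltnS leq_maxr.
pose m (u : R) := (Num.truncn (2 `^ (t%:R * u))).+1.
have mP u : 0 <= u -> t%:R * u <= log2 (m u)%:R <= t%:R * u + 1.
  by move=> u0; apply: log2_truncn_powR; rewrite mulr_ge0.
(* The extra factor 2 in the second count matches the 2 in [2 |a| ^ t < n1 n2]; it costs one bit
   beyond the rounding. *)
exists (t%:R^-1 * log2 (m h1)%:R, t%:R^-1 * log2 (2 * m h2)%:R); split.
  exists t; first by rewrite /= leqW// leq_maxl.
  apply: impulse_entropy_pairs => //.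
  rewrite mulnCA natrM ltr_pM2l// natrM.
  have at0 : 0 < `|a| ^+ t by rewrite exprn_gt0//; lra.
  have -> : `|a| ^+ t = 2 `^ (t%:R * log2 `|a|).
    rewrite -log2X//; last by lra.
    by rewrite /powR ifF ?divfK ?lnK// ?posrE ?gt_eqF ?ln2_gt0.
  apply: le_lt_trans (_ : 2 `^ (t%:R * h1) * 2 `^ (t%:R * h2) < _).
    rewrite -powRD; last by rewrite pnatr_eq0 implybT.
    by apply: ler_powR; [lra|rewrite -mulrDr ler_pM2l].
  by apply: ltr_pM; rewrite ?powR_ge0// truncnS_gt.
apply: eB; have /andP[l1 r1] := mP _ h10; have /andP[l2 r2] := mP _ h20.
have close (u v : R) : t%:R * u <= v <= t%:R * u + 2 -> ball u e (t%:R^-1 * v).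
  move=> /andP[uv vu]; rewrite -ball_normE /ball_/= distrC.
  rewrite ger0_norm ?subr_ge0 ?ler_pdivlMl//.
  by rewrite ltrBlDr ltr_pdivrMl//; lra.
split; apply: close => /=; first by apply/andP; split; lra.
by rewrite natrM log2M ?ltr0n// log2_2; apply/andP; split; lra.
Qed.

End UpperBound.

(** * Closedness of the region and conclusion *)

Lemma closed_entropy_region (R : realType) (c : R) :
  closed [set h : R * R | [/\ 0 <= h.1, 0 <= h.2 & c <= h.1 + h.2]].
Proof.
rewrite (_ : [set _ | _] = [set h | 0 <= h.1] `&` [set h | 0 <= h.2] `&`
    [set h : R * R | c <= h.1 + h.2]); last first.
  by apply/seteqP; split=> h; [case=> ? ? ?|case=> -[? ?] ?]; do ?split.
apply: closedI; first apply: closedI.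
- by apply: (@preimage_closed _ _ fst [set u : R | 0 <= u]) => // h _; exact: cvg_fst.
- by apply: (@preimage_closed _ _ snd [set u : R | 0 <= u]) => // h _; exact: cvg_snd.
- apply: (@preimage_closed _ _ (fun h : R * R => h.1 + h.2) [set u : R | c <= u]) => //.
  by move=> h _; apply: cvgD; [exact: cvg_fst|exact: cvg_snd].
Qed.

Theorem mainTheorem4 (R : realType) (alpha : int) (halpha : 2 <= `|alpha|) :
  exists2 delta0 : R, 0 < delta0 &
    forall delta : R, 0 < delta < delta0 ->
      network_entropy_set R (circle_system R alpha) (circle_system R alpha)
        (practical_synchronization delta) =
      [set h : R * R | [/\ 0 <= h.1, 0 <= h.2 &
        log2 (`|alpha|%:~R) <= h.1 + h.2]].
Proof.
set a : R := alpha%:~R.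
have a2 : 2 <= `|a| by rewrite -intr_norm -[2]/(2%:~R) ler_int.
(* Below this threshold [2 delta + 2 |a| delta < 1], which excludes wrapping and also keeps the
   impulses in [[-1, 1]]. *)
exists (2 + 2 * `|a|)^-1; first by rewrite invr_gt0; lra.
move=> delta /andP[d0]; rewrite -[X in _ < X]mul1r ltr_pdivlMr; last by lra.
move=> dsmall.
have dsmall' : 2 * delta + 2 * `|a| * delta < 1.
  by move: dsmall; congr (_ < _); ring.
(* The lower bound holds for every [t >= 1] and the region is closed, so the single closure at
   [tau = 1] already lies in it. *)
apply/seteqP; split=> [h /(_ 1%N isT) Hh|h [h1 h2 h12] tau /= _].
  have /closure_id -> := closed_entropy_region R (log2 (`|alpha|%:~R)).
  apply: closureS Hh => {}h [t /= t1].
  exact: (entropy_pairs_lower_bound alpha delta t h halpha d0 dsmall' t1).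
by apply: upper_bound_closure => //; [lra|lra|rewrite -intr_norm].
Qed.
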